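(* Let $\mathbb K$ be an algebraically closed field of characteristic $p>2$ and let $\mathfrak g=\mathfrak{osp}(1|2)$ with basis $x_1,y_1$ (odd), $h_1=[x_1,y_1]$, $x_2=x_1^2=\tfrac12[x_1,x_1]$, $y_2=y_1^2=\tfrac12[y_1,y_1]$ (even), where $[h_1,x_1]=x_1$, $[h_1,y_1]=-y_1$. If $p>3$, then $H^1(\mathfrak g;\mathfrak g)=0$ and $H^2(\mathfrak g)=0$. If $p=3$, then: (a) for a basis of $H^1(\mathfrak g;\mathfrak g)$ one can take the classes of the following two odd derivations (sending to $0$ the basis elements that are not mentioned): $$D_{-3}:\ x_1\mapsto y_2,\ x_2\mapsto y_1;\qquad D_{3}:\ y_1\mapsto x_2,\ y_2\mapsto -x_1;$$ (b) $H^2(\mathfrak g)=0$.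
   Context: $H^1(\mathfrak g;\mathfrak g)$ is the superspace of all (even and odd) derivations, $D[x,y]=[Dx,y]+(-1)^{p(D)p(x)}[x,Dy]$, modulo inner ones. $H^2(\mathfrak g)$ is cohomology with trivial coefficients (both parities), classifying one-dimensional central extensions: a 2-cocycle is a bilinear form $\omega$ with $\omega(x,y)=-(-1)^{p(x)p(y)}\omega(y,x)$, $\omega([x,y],z)=\omega(x,[y,z])-(-1)^{p(x)p(y)}\omega(y,[x,z])$ and, for $p=3$, also $\omega(x,[x,x])=0$ for all odd $x$; coboundaries are $\omega(x,y)=f([x,y])$ for linear $f$. (For $p=3$, Lie superalgebras are required to satisfy $[x,[x,x]]=0$ for odd $x$.) *)

(* Defs.v *)
From HB Require Import structures.
From mathcomp Require Import all_boot all_order all_algebra.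
From mathcomp Require Import boolp ring.

Set Implicit Arguments.
Unset Strict Implicit.
Unset Printing Implicit Defensive.

Import GRing.Theory.
Local Open Scope ring_scope.

Section Subspaces.
Variables (K : fieldType) (E : vectType K).

Lemma vspace_of_subproof (P : E -> Prop) :
  exists U : {vspace E},
    P 0 -> (forall (a : K) u v, P u -> P v -> P (a *: u + v)) ->
    forall v, v \in U <-> P v.
Proof.
have [[P0 Plin]|nP] :=
  pselect (P 0 /\ forall (a : K) u v, P u -> P v -> P (a *: u + v)); last first.
  by exists 0%VS => P0 Plin; case: nP.
pose Q n := `[< exists2 U : {vspace E}, \dim U = n & forall v, v \in U -> P v >].
have exQ : exists n, Q n.
  exists 0%N; apply/asboolP; exists 0%VS; first exact: dimv0.
  by move=> v; rewrite memv0 => /eqP->.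
have ubQ n : Q n -> (n <= \dim {:E})%N.
  by move=> /asboolP [U <- _]; rewrite dimvS ?subvf.
case: (ex_maxnP exQ ubQ) => n /asboolP[U dimU sUP] maxn; exists U => _ _ v.
split=> [|Pv]; first exact: sUP.
have sP w : w \in (U + <[v]>)%VS -> P w.
  case/memv_addP=> u /sUP Pu [w' /vlineP[k ->] ->]; rewrite addrC; exact: Plin.
have /maxn : Q (\dim (U + <[v]>)%VS) by apply/asboolP; exists (U + <[v]>)%VS.
rewrite -dimU => le_dim.
have /eqP -> : U == (U + <[v]>)%VS by rewrite eqEdim addvSl.
by rewrite (subvP (addvSr _ _)) ?memv_line.
Qed.

(* The subspace { v | P v }; meaningful only when P is stable under linear
   combinations. *)
Definition vspace_of (P : E -> Prop) : {vspace E} :=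
  projT1 (cid (vspace_of_subproof P)).

Lemma mem_vspace_of (P : E -> Prop) v :
  P 0 -> (forall (a : K) u w, P u -> P w -> P (a *: u + w)) ->
  v \in vspace_of P <-> P v.
Proof. by move=> P0 Plin; rewrite /vspace_of; case: cid => U /=; apply. Qed.

End Subspaces.

Section QuotientSpace.
Variables (K : fieldType) (E : vectType K) (W : {vspace E}).

(* [Quotient.quot] is the quotient of a zmodType; the vector space structure is
   added below. *)
Definition quotv : Type := Quotient.quot (pred_of_vspace W : zmodClosed E).
HB.instance Definition _ := GRing.Zmodule.on quotv.

Definition piv (x : E) : quotv :=
  (\pi_(quotv) x)%qT.

Lemma piv_eq x y : (piv x == piv y) = (x - y \in W).
Proof. by rewrite /piv -Quotient.idealrBE. Qed.

Lemma pivP x y : piv x = piv y <-> x - y \in W.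
Proof. by rewrite -piv_eq; split=> [->|/eqP]. Qed.

Lemma pivB : {morph piv : x y / x - y}.
Proof. by move=> x y; rewrite /piv raddfB. Qed.

Lemma pivD : {morph piv : x y / x + y}.
Proof. by move=> x y; rewrite /piv raddfD. Qed.

Lemma piv_surj (q : quotv) : exists x, q = piv x.
Proof. by exists (repr q); rewrite /piv reprK. Qed.

Definition scaleq (a : K) (q : quotv) : quotv := piv (a *: repr q).

Lemma scaleqE a x : scaleq a (piv x) = piv (a *: x).
Proof.
rewrite /scaleq; apply/pivP; rewrite -scalerBr memvZ //.
by apply/pivP; rewrite /piv reprK.
Qed.

Fact scaleqA a b q : scaleq a (scaleq b q) = scaleq (a * b) q.
Proof. by have [x ->] := piv_surj q; rewrite !scaleqE scalerA. Qed.
Fact scale1q : left_id 1 scaleq.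
Proof. by move=> q; have [x ->] := piv_surj q; rewrite scaleqE scale1r. Qed.
Fact scaleqDr : right_distributive scaleq +%R.
Proof.
move=> a q r; have [x ->] := piv_surj q; have [y ->] := piv_surj r.
by rewrite -pivD !scaleqE -pivD scalerDr.
Qed.
Fact scaleqDl q : {morph scaleq^~ q : a b / a + b}.
Proof.
by move=> a b; have [x ->] := piv_surj q; rewrite !scaleqE -pivD scalerDl.
Qed.
HB.instance Definition _ :=
  GRing.Zmodule_isLmodule.Build K quotv scaleqA scale1q scaleqDr scaleqDl.

Lemma piv_is_linear : linear piv.
Proof. by move=> a x y; rewrite pivD -scaleqE. Qed.
HB.instance Definition _ := GRing.isSemilinear.Build K E quotv _ piv
  (GRing.semilinear_linear piv_is_linear).

Lemma piv_eq0 x : (piv x == 0) = (x \in W).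
Proof. by rewrite -(linear0 piv) piv_eq subr0. Qed.

Let C := (W^C)%VS.

Let capCW x : x \in C -> x \in W -> x = 0.
Proof.
by move=> xC xW; apply/eqP; rewrite -memv0 -(capv_compl W) memv_cap xW.
Qed.

Let decomp x : exists2 c, c \in C & piv x = piv c.
Proof.
have : x \in (W + C)%VS by rewrite addv_complf memvf.
case/memv_addP=> w wW [c cC ->]; exists c => //.
by apply/pivP; rewrite addrK.
Qed.

Fact quotv_vect_iso : Vector.axiom (\dim C) quotv.
Proof.
pose r (v : 'rV[K]_(\dim C)) : quotv := piv (\sum_i v 0 i *: (vbasis C)`_i).
have r_lin : linear r.
  move=> a u v; rewrite /r -linearP /= scaler_sumr -big_split /=.
  by congr piv; apply: eq_bigr => i _; rewrite !mxE scalerDl scalerA.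
have memC (v : 'rV[K]_(\dim C)) : \sum_i v 0 i *: (vbasis C)`_i \in C.
  by apply: rpred_sum => i _; rewrite rpredZ ?vbasis_mem ?memt_nth.
have r_inj : injective r.
  move=> u v /pivP uvW; apply/rowP=> i.
  have /capCW/(_ uvW)/eqP := rpredB (memC u) (memC v).
  rewrite subr_eq0 => /eqP/(congr1 (coord (vbasis C) i)).
  by rewrite !coord_sum_free ?(basis_free (vbasisP C)).
have r_surj q : exists v, r v == q.
  have [x ->] := piv_surj q; have [c cC ->] := decomp x.
  exists (\row_i coord (vbasis C) i c); apply/eqP.
  rewrite /r {2}(coord_vbasis cC); congr piv.
  by apply: eq_bigr => i _; rewrite mxE.
pose s q := xchoose (r_surj q).
have rK q : r (s q) = q by apply/eqP/(xchooseP (r_surj q)).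
exists s; last by exists r => // v; apply: r_inj; rewrite rK.
by move=> a p q; apply: r_inj; rewrite rK r_lin !rK.
Qed.
HB.instance Definition _ := Lmodule_hasFinDim.Build K quotv quotv_vect_iso.

(* Subquotients: the image of Z in E / W, i.e. the space of classes of the
   elements of Z. *)
Definition classes_of (Z : {vspace E}) : {vspace quotv} := (linfun piv @: Z)%VS.

Lemma classes_ofP (Z : {vspace E}) q :
  reflect (exists2 z, z \in Z & q = piv z) (q \in classes_of Z).
Proof.
by apply: (iffP memv_imgP) => -[z zZ ->]; exists z => //; rewrite lfunE.
Qed.

End QuotientSpace.

Lemma linfunE (K : fieldType) (U V : vectType K) (f : U -> V) : linear f -> linfun f =1 f.
Proof.
move=> lf; pose fM := GRing.isLinear.Build K U V _ f lf.
pose fL : {linear U -> V} := HB.pack f fM.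
exact: (lfunE fL).
Qed.

Section Linfun.
Variables (K : fieldType) (U V W : vectType K).

Definition bilinfun (f : U -> V -> W) : 'Hom(U, 'Hom(V, W)) :=
  linfun (fun x => linfun (f x)).

Lemma bilinfunE (f : U -> V -> W) :
  (forall x, linear (f x)) -> (forall y, linear (f^~ y)) ->
  forall x y, bilinfun f x y = f x y.
Proof.
move=> lr ll x y; rewrite /bilinfun linfunE ?linfunE // => a u v.
by apply/lfunP=> w; rewrite !lfun_simp !linfunE // ll.
Qed.

(* The linear map sending the i-th vector of the basis b to the i-th entry
   of s. *)
Definition basis_map (b : seq U) (s : seq V) : 'Hom(U, V) :=
  linfun (sval (linear_of_free b s)).

Lemma basis_mapE (b : seq U) (s : seq V) :
  basis_of fullv b -> size s = size b -> map (basis_map b s) b = s.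
Proof.
move=> /basis_free fb eqs; rewrite /basis_map; case: linear_of_free => f /= fE.
by rewrite -[RHS]fE //; apply: eq_map => u; rewrite lfunE.
Qed.

End Linfun.

(* Parities are booleans, [true] being odd, added by [(+)] and multiplied by
   [&&]; [gr b] is the homogeneous component of parity b. In characteristic 2
   the axioms below are not the usual ones. *)
Record lieSuperalgebra (K : fieldType) := LieSuperalgebra {
  lsort :> vectType K;
  gr : bool -> {vspace lsort};
  br : 'Hom(lsort, 'Hom(lsort, lsort));
  gr_full : (gr false + gr true = fullv)%VS;
  gr_cap : (gr false :&: gr true = 0)%VS;
  br_gr : forall a b x y, x \in gr a -> y \in gr b -> br x y \in gr (a (+) b);
  br_skew : forall a b x y, x \in gr a -> y \in gr b ->
    br x y = - ((-1) ^+ (a && b) *: br y x);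
  br_jacobi : forall a b x y z, x \in gr a -> y \in gr b ->
    br x (br y z) = br (br x y) z + (-1) ^+ (a && b) *: br y (br x z);
  br_cubic : 3%N \in [pchar K] ->
    forall x, x \in gr true -> br x (br x x) = 0
}.

Arguments gr {K} g : rename.
Arguments br {K g} : rename.

Section Cohomology.
Variables (K : fieldType) (g : lieSuperalgebra K).

Definition is_derivation (a : bool) (D : 'End(g)) : Prop :=
  (forall b x, x \in gr g b -> D x \in gr g (a (+) b)) /\
  (forall b x y, x \in gr g b ->
     D (br x y) = br (D x) y + (-1) ^+ (a && b) *: br x (D y)).

Definition Der_ (a : bool) : {vspace 'End(g)} := vspace_of (is_derivation a).
(* All derivations, i.e. sums of an even and an odd one. *)
Definition Der : {vspace 'End(g)} := (Der_ false + Der_ true)%VS.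

(* [br x] is the endomorphism [ad x]. *)
Definition Inn : {vspace 'End(g)} := limg (br : 'Hom(g, 'End(g))).

Definition H1 : {vspace quotv Inn} := classes_of Inn Der.

(* No parity condition on the form itself: [H2] contains both parities. *)
Definition is_cocycle2 (w : 'Hom(g, 'Hom(g, K^o))) : Prop :=
  [/\ forall a b x y, x \in gr g a -> y \in gr g b ->
        w x y = - ((-1) ^+ (a && b) * w y x),
      forall a b x y z, x \in gr g a -> y \in gr g b ->
        w (br x y) z = w x (br y z) - (-1) ^+ (a && b) * w y (br x z)
    & 3%N \in [pchar K] -> forall x, x \in gr g true -> w x (br x x) = 0].

Definition is_coboundary2 (w : 'Hom(g, 'Hom(g, K^o))) : Prop :=
  exists f : 'Hom(g, K^o), forall x y, w x y = f (br x y).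

Definition Z2 : {vspace 'Hom(g, 'Hom(g, K^o))} := vspace_of is_cocycle2.
Definition B2 : {vspace 'Hom(g, 'Hom(g, K^o))} := vspace_of is_coboundary2.
Definition H2 : {vspace quotv B2} := classes_of B2 Z2.

Lemma mem_Der_ a D : D \in Der_ a <-> is_derivation a D.
Proof.
apply: mem_vspace_of => [|c D1 D2 [g1 d1] [g2 d2]].
  split=> [b x _|b x y _]; rewrite !zero_lfunE ?mem0v // !linear0 zero_lfunE.
  by rewrite addr0.
split=> [b x xb|b x y xb]; rewrite !lfun_simp ?rpredD ?rpredZ ?g1 ?g2 //.
rewrite (d1 b) // (d2 b) // !linearP !lfun_simp /= !scalerDr !scalerA.
by rewrite [c * _]mulrC addrACA.
Qed.

Lemma mem_Z2 w : w \in Z2 <-> is_cocycle2 w.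
Proof.
apply: mem_vspace_of => [|c u v [u1 u2 u3] [v1 v2 v3]].
  by split=> *; rewrite !lfunE /= ?lfunE /= ?mulr0 ?subr0 ?oppr0.
split=> [a b x y xa yb|a b x y z xa yb|p3 x x1]; rewrite !lfun_simp.
- rewrite (u1 a b) // (v1 a b) // mulrDr opprD scalerN.
  by congr (- _ - _); rewrite /GRing.scale /= mulrCA.
- rewrite (u2 a b) // (v2 a b) // mulrDr opprD scalerBr addrACA.
  by congr (_ + (- _ - _)); rewrite /GRing.scale /= mulrCA.
- by rewrite u3 // v3 // scaler0 addr0.
Qed.

Lemma mem_B2 w : w \in B2 <-> is_coboundary2 w.
Proof.
apply: mem_vspace_of => [|c u v [f fE] [f' fE']].
  by exists 0 => x y; rewrite !zero_lfunE.
by exists (c *: f + f') => x y; rewrite !lfun_simp fE fE'.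
Qed.

Lemma Inn_sub_Der : (Inn <= Der)%VS.
Proof.
apply/subvP=> _ /memv_imgP[z _ ->].
have : z \in (gr g false + gr g true)%VS by rewrite gr_full memvf.
case/memv_addP=> z0 z0P [z1 z1P ->]; rewrite linearD /=.
have adP a t : t \in gr g a -> (br t : 'End(g)) \in Der_ a.
  move=> ta; apply/mem_Der_; split=> [b x xb|b x y xb]; first exact: br_gr.
  exact: br_jacobi.
by apply: memv_add; apply: adP.
Qed.

Lemma B2_sub_Z2 : (B2 <= Z2)%VS.
Proof.
apply/subvP=> w /mem_B2[f fE]; apply/mem_Z2; split.
- by move=> a b x y xa yb; rewrite !fE (br_skew xa yb) linearN linearZ.
- move=> a b x y z xa yb; rewrite !fE (br_jacobi z xa yb) linearD linearZ /=.
  by rewrite /GRing.scale /= addrK.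
- by move=> p3 x x1; rewrite fE br_cubic // linear0.
Qed.

End Cohomology.

Section GeneralLinear.
Variables (K : fieldType) (n : nat) (par : 'I_n -> bool).

Definition mxpart (b : bool) (A : 'M[K]_n) : 'M[K]_n :=
  \matrix_(i, j) (if par i (+) par j == b then A i j else 0).

Definition glgr (b : bool) : {vspace 'M[K]_n} :=
  vspace_of (fun A : 'M[K]_n => forall i j, par i (+) par j != b -> A i j = 0).

(* Bilinear extension of AB - (-1)^(p(A) p(B)) BA. *)
Definition supercomm (A B : 'M[K]_n) : 'M[K]_n :=
  \sum_(a : bool) \sum_(b : bool)
    (mxpart a A *m mxpart b B
     - (-1) ^+ (a && b) *: (mxpart b B *m mxpart a A)).

Lemma mem_glgr b A :
  A \in glgr b <-> (forall i j, par i (+) par j != b -> A i j = 0).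
Proof.
apply: mem_vspace_of => [i j _|c u v uP vP i j ij]; rewrite !mxE //.
by rewrite uP ?vP // mulr0 addr0.
Qed.

Lemma mxpart_gr b A : mxpart b A \in glgr b.
Proof. by apply/mem_glgr=> i j /negbTE ij; rewrite mxE ij. Qed.

Lemma mxpart_id a b A : A \in glgr a -> mxpart b A = if a == b then A else 0.
Proof.
move/mem_glgr=> AP; apply/matrixP=> i j; rewrite mxE.
case: (eqVneq a b) => [<-|ne]; case: eqP => [e|/eqP ne'] //; rewrite ?mxE //.
- by rewrite AP.
- by apply: AP; rewrite e eq_sym.
Qed.

Lemma mxpartD A : A = mxpart false A + mxpart true A.
Proof.
by apply/matrixP=> i j; rewrite !mxE; case: (_ (+) _); rewrite ?addr0 ?add0r.
Qed.

Lemma mxpart_linear b : linear (mxpart b).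
Proof.
by move=> c A B; apply/matrixP=> i j; rewrite !mxE; case: eqP; rewrite ?mulr0 ?addr0.
Qed.
HB.instance Definition _ b := GRing.isSemilinear.Build K 'M[K]_n 'M[K]_n _
  (mxpart b) (GRing.semilinear_linear (mxpart_linear b)).

Lemma glgr_mul a b A B : A \in glgr a -> B \in glgr b -> A *m B \in glgr (a (+) b).
Proof.
move=> /mem_glgr AP /mem_glgr BP; apply/mem_glgr=> i j ij; rewrite mxE big1 // => k _.
have [e|/AP ->] := eqVneq (par i (+) par k) a; last by rewrite mul0r.
have [e'|/BP ->] := eqVneq (par k (+) par j) b; last by rewrite mulr0.
by case/negP: ij; rewrite -e -e' addbA -[_ (+) _ (+) par k]addbA addbb addbF.
Qed.

Lemma supercommE a b A B : A \in glgr a -> B \in glgr b ->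
  supercomm A B = A *m B - (-1) ^+ (a && b) *: (B *m A).
Proof.
move=> Aa Bb; rewrite /supercomm !big_bool /=.
rewrite !(mxpart_id _ Aa) !(mxpart_id _ Bb).
by case: (a); case: (b) => /=;
   rewrite !(mul0mx, mulmx0, scaler0, oppr0, addr0, add0r).
Qed.

Lemma supercomm_linr A : linear (supercomm A).
Proof.
move=> c B B'; rewrite /supercomm scaler_sumr -big_split; apply: eq_bigr => a _.
rewrite scaler_sumr -big_split; apply: eq_bigr => b _.
rewrite !linearP /= mulmxDl -scalemxAl scalerBr !scalerDr opprD addrACA.
by rewrite !scalerA mulrC.
Qed.

Lemma supercomm_linl B : linear (supercomm^~ B).
Proof.
move=> c A A'; rewrite /supercomm scaler_sumr -big_split; apply: eq_bigr => a _.
rewrite scaler_sumr -big_split; apply: eq_bigr => b _.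
by rewrite !linearP /= mulmxDl -scalemxAl scalerDr addrACA.
Qed.

Definition gl_br : 'Hom('M[K]_n, 'Hom('M[K]_n, 'M[K]_n)) := bilinfun supercomm.

Lemma gl_brE A B : gl_br A B = supercomm A B.
Proof. exact: (bilinfunE supercomm_linr supercomm_linl). Qed.

Fact glgr_full : (glgr false + glgr true = fullv)%VS.
Proof.
apply/vspaceP=> A; rewrite memvf.
by rewrite [A]mxpartD memv_add ?mxpart_gr.
Qed.

Fact glgr_cap : (glgr false :&: glgr true = 0)%VS.
Proof.
apply/eqP; rewrite -subv0; apply/subvP=> A; rewrite memv_cap memv0.
case/andP=> /mem_glgr A0 /mem_glgr A1; apply/eqP/matrixP=> i j; rewrite mxE.
by case E : (par i (+) par j); [apply: A0|apply: A1]; rewrite E.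
Qed.

Fact gl_br_gr a b A B : A \in glgr a -> B \in glgr b -> gl_br A B \in glgr (a (+) b).
Proof.
move=> Aa Bb; rewrite gl_brE (supercommE Aa Bb) rpredB ?rpredZ //.
  exact: glgr_mul.
by rewrite addbC glgr_mul.
Qed.

Fact gl_br_skew a b A B : A \in glgr a -> B \in glgr b ->
  gl_br A B = - ((-1) ^+ (a && b) *: gl_br B A).
Proof.
move=> Aa Bb; rewrite !gl_brE (supercommE Aa Bb) (supercommE Bb Aa) andbC.
by rewrite scalerBr scalerA -signr_addb addbb scale1r opprB.
Qed.

Fact gl_br_jacobi a b A B C : A \in glgr a -> B \in glgr b ->
  gl_br A (gl_br B C) =
  gl_br (gl_br A B) C + (-1) ^+ (a && b) *: gl_br B (gl_br A C).
Proof.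
move=> Aa Bb.
suff H c D : D \in glgr c -> gl_br A (gl_br B D) =
    gl_br (gl_br A B) D + (-1) ^+ (a && b) *: gl_br B (gl_br A D).
  rewrite [C]mxpartD !linearD /= addrACA.
  by congr (_ + _); apply: H (mxpart_gr _ _).
move=> Dc.
have BD := gl_br_gr Bb Dc; have AB := gl_br_gr Aa Bb; have AD := gl_br_gr Aa Dc.
rewrite [LHS]gl_brE (supercommE Aa BD) [gl_br (gl_br _ _) _]gl_brE.
rewrite (supercommE AB Dc) [gl_br B (gl_br A D)]gl_brE (supercommE Bb AD).
rewrite !gl_brE (supercommE Aa Bb) (supercommE Bb Dc) (supercommE Aa Dc).
rewrite !(mulmxBl, mulmxBr) -!(scalemxAl, scalemxAr) !mulmxA.
set ABD := A *m B *m D; set ADB := A *m D *m B; set BDA := B *m D *m A.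
set DBA := D *m B *m A; set BAD := B *m A *m D; set DAB := D *m A *m B.
move: ABD ADB BDA DBA BAD DAB => m1 m2 m3 m4 m5 m6.
by case: a b c {Aa Bb Dc AB BD AD} => -[] [] /=;
   rewrite ?expr0 ?expr1 ?scale1r ?scaleN1r ?opprK ?opprD ?opprK ?opprB;
   apply/matrixP=> i j; rewrite !mxE; ring.
Qed.

Fact gl_br_cubic : 3%N \in [pchar K] ->
  forall A, A \in glgr true -> gl_br A (gl_br A A) = 0.
Proof.
move=> _ A A1; have AA := gl_br_gr A1 A1.
rewrite [LHS]gl_brE (supercommE A1 AA) gl_brE (supercommE A1 A1) /=.
by rewrite expr0 expr1 scaleN1r scale1r opprK mulmxDl mulmxDr mulmxA subrr.
Qed.

Definition gl : lieSuperalgebra K :=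
  LieSuperalgebra glgr_full glgr_cap gl_br_gr gl_br_skew gl_br_jacobi gl_br_cubic.

End GeneralLinear.

Section SubSuperalgebra.
Variables (K : fieldType) (g : lieSuperalgebra K) (U : {vspace g}).
Hypothesis U_gr : (U <= (U :&: gr g false) + (U :&: gr g true))%VS.
Hypothesis U_br : forall x y, x \in U -> y \in U -> br x y \in U.

Definition sub_gr (b : bool) : {vspace subvs_of U} :=
  (linfun (vsval : subvs_of U -> g) @^-1: gr g b)%VS.

Lemma mem_sub_gr b (x : subvs_of U) : (x \in sub_gr b) = (vsval x \in gr g b).
Proof. by rewrite -memv_preim lfunE. Qed.

Definition sub_br : 'Hom(subvs_of U, 'Hom(subvs_of U, subvs_of U)) :=
  bilinfun (fun x y => vsproj U (br (vsval x) (vsval y))).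

Lemma vsval_sub_br (x y : subvs_of U) :
  vsval (sub_br x y) = br (vsval x) (vsval y).
Proof.
rewrite /sub_br bilinfunE ?vsprojK ?U_br ?subvsP // => z c u v.
  by rewrite !linearP.
by rewrite /= !linearP !lfun_simp !linearP.
Qed.

Fact sub_gr_full : (sub_gr false + sub_gr true = fullv)%VS.
Proof.
apply/vspaceP=> x; rewrite memvf.
have /(subvP U_gr)/memv_addP[u] := subvsP x; rewrite memv_cap => /andP[uU u0].
case=> v; rewrite memv_cap => /andP[vU v1] xE.
have -> : x = vsproj U u + vsproj U v.
  by apply: subvs_inj; rewrite linearD /= !vsprojK.
by rewrite memv_add ?mem_sub_gr ?vsprojK.
Qed.

Fact sub_gr_cap : (sub_gr false :&: sub_gr true = 0)%VS.
Proof.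
apply/eqP; rewrite -subv0; apply/subvP=> x.
rewrite memv_cap !mem_sub_gr -memv_cap gr_cap !memv0 => /eqP x0.
by apply/eqP/subvs_inj; rewrite x0 linear0.
Qed.

Fact sub_br_gr a b (x y : subvs_of U) :
  x \in sub_gr a -> y \in sub_gr b -> sub_br x y \in sub_gr (a (+) b).
Proof. by rewrite !mem_sub_gr vsval_sub_br; apply: br_gr. Qed.

Fact sub_br_skew a b (x y : subvs_of U) : x \in sub_gr a -> y \in sub_gr b ->
  sub_br x y = - ((-1) ^+ (a && b) *: sub_br y x).
Proof.
rewrite !mem_sub_gr => xa yb; apply: subvs_inj.
by rewrite linearN linearZ /= !vsval_sub_br (br_skew xa yb) scalerN.
Qed.

Fact sub_br_jacobi a b (x y z : subvs_of U) : x \in sub_gr a -> y \in sub_gr b ->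
  sub_br x (sub_br y z) =
  sub_br (sub_br x y) z + (-1) ^+ (a && b) *: sub_br y (sub_br x z).
Proof.
rewrite !mem_sub_gr => xa yb; apply: subvs_inj.
by rewrite linearD linearZ /= !vsval_sub_br; apply: br_jacobi.
Qed.

Fact sub_br_cubic : 3%N \in [pchar K] ->
  forall x : subvs_of U, x \in sub_gr true -> sub_br x (sub_br x x) = 0.
Proof.
move=> p3 x; rewrite mem_sub_gr => x1; apply: subvs_inj.
by rewrite !vsval_sub_br linear0 br_cubic.
Qed.

Definition subsuper : lieSuperalgebra K :=
  LieSuperalgebra sub_gr_full sub_gr_cap sub_br_gr sub_br_skew sub_br_jacobi
    sub_br_cubic.

End SubSuperalgebra.

Section Orthosymplectic.
Variables (K : fieldType) (n : nat) (par : 'I_n -> bool) (B : 'M[K]_n).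

Definition bform (v w : 'cV[K]_n) : K := (v^T *m B *m w) 0 0.

Definition homog (b : bool) (v : 'cV[K]_n) : Prop :=
  forall i, par i != b -> v i 0 = 0.

Definition preserves_form (A : 'M[K]_n) : Prop :=
  forall a b v w, homog b v ->
    bform (mxpart par a A *m v) w
    + (-1) ^+ (a && b) * bform v (mxpart par a A *m w) = 0.

Definition osp_space : {vspace gl K par} := vspace_of preserves_form.

Lemma bformDl u v w : bform (u + v) w = bform u w + bform v w.
Proof. by rewrite /bform linearD /= !mulmxDl mxE. Qed.
Lemma bformDr u v w : bform w (u + v) = bform w u + bform w v.
Proof. by rewrite /bform mulmxDr mxE. Qed.
Lemma bformZl c v w : bform (c *: v) w = c * bform v w.
Proof. by rewrite /bform linearZ /= -!scalemxAl mxE. Qed.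
Lemma bformZr c v w : bform w (c *: v) = c * bform w v.
Proof. by rewrite /bform -scalemxAr mxE. Qed.

Lemma mem_osp A : A \in osp_space <-> preserves_form A.
Proof.
apply: mem_vspace_of => [a b v w _|c A1 A2 P1 P2 a b v w vb].
  by rewrite linear0 !mul0mx /bform linear0 mulmx0 !mul0mx mxE mulr0 addr0.
rewrite linearP /= !mulmxDl -!scalemxAl bformDl bformDr bformZl bformZr.
rewrite mulrDr addrACA P2 // addr0 mulrCA -mulrDr P1 // mulr0 //.
Qed.

Lemma preserves_part a A : preserves_form A -> preserves_form (mxpart par a A).
Proof.
move=> AP c b v w vb; rewrite (mxpart_id _ (mxpart_gr par a A)).
case: eqP => [->|_]; first exact: AP.
by rewrite !mul0mx /bform linear0 mulmx0 !mul0mx mxE mulr0 addr0.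
Qed.

Lemma homog_mul a b A v : A \in glgr K par a -> homog b v -> homog (a (+) b) (A *m v).
Proof.
move=> /mem_glgr AP vP i iP; rewrite mxE big1 // => k _.
have [e|/AP ->] := eqVneq (par i (+) par k) a; last by rewrite mul0r.
have [e'|/vP ->] := eqVneq (par k) b; last by rewrite mulr0.
by case/negP: iP; rewrite -e -e' -addbA addbb addbF.
Qed.

Lemma preserves_homog a b A v w : A \in glgr K par a -> preserves_form A ->
  homog b v -> bform (A *m v) w = - ((-1) ^+ (a && b) * bform v (A *m w)).
Proof.
move=> Aa AP vb; have := AP a b v w vb; rewrite (mxpart_id _ Aa) eqxx.
by move/eqP; rewrite addr_eq0 => /eqP.
Qed.

Lemma preserves_supercomm_homog a a' A A' :
  A \in glgr K par a -> A' \in glgr K par a' ->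
  preserves_form A -> preserves_form A' -> preserves_form (supercomm par A A').
Proof.
move=> Aa Aa' AP AP' c b v w vb.
have : supercomm par A A' \in glgr K par (a (+) a').
  by rewrite -gl_brE gl_br_gr.
move=> /(mxpart_id c) ->; case: eqP => [<-{c}|_]; last first.
  by rewrite !mul0mx /bform linear0 mulmx0 !mul0mx mxE mulr0 addr0.
rewrite (supercommE Aa Aa') !mulmxBl -!scalemxAl -!mulmxA.
rewrite -!scaleN1r !(bformDl, bformDr, bformZl, bformZr).
have vb' := homog_mul Aa vb; have vb'' := homog_mul Aa' vb.
rewrite (preserves_homog _ Aa AP vb'') (preserves_homog _ Aa' AP' vb').
rewrite (preserves_homog _ Aa' AP' vb) (preserves_homog _ Aa AP vb).
by case: (a) (a') (b) => -[] [] /=; ring.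
Qed.

Fact osp_gr : (osp_space <= (osp_space :&: gr (gl K par) false)
                          + (osp_space :&: gr (gl K par) true))%VS.
Proof.
apply/subvP=> A /mem_osp AP; rewrite [A](mxpartD par).
by apply: memv_add; rewrite memv_cap mxpart_gr andbT; apply/mem_osp/preserves_part.
Qed.

Fact osp_br (A A' : gl K par) :
  A \in osp_space -> A' \in osp_space -> br A A' \in osp_space.
Proof.
move=> /mem_osp AP /mem_osp AP'.
rewrite [A](mxpartD par) [A'](mxpartD par) !linearD /= !add_lfunE.
suff H a a' : br (mxpart par a A : gl K par) (mxpart par a' A') \in osp_space.
  by rewrite !memvD.
apply/mem_osp; rewrite /= gl_brE.
by apply: preserves_supercomm_homog (mxpart_gr _ _ _) (mxpart_gr _ _ _) _ _;
  apply: preserves_part.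
Qed.

Definition osp : lieSuperalgebra K := subsuper osp_gr osp_br.

End Orthosymplectic.

Section Osp12.
Variable K : fieldType.

(* K^(1|2) with even basis vector e_0 and odd basis vectors e_1, e_2; the form
   is even and supersymmetric: symmetric on the even part, alternating on the
   odd part. *)
Definition par12 (i : 'I_3) : bool := i != 0 :> nat.

Definition form12 : 'M[K]_3 :=
  \matrix_(i, j) match nat_of_ord i, nat_of_ord j with
                 | 0%N, 0%N => 1
                 | 1%N, 2%N => 1
                 | 2%N, 1%N => -1
                 | _, _ => 0
                 end.

Definition osp12 : lieSuperalgebra K := osp par12 form12.

End Osp12.

Definition is_osp12_basis (K : fieldType) (g : lieSuperalgebra K)
    (x1 y1 h1 x2 y2 : g) : Prop :=
  [/\ basis_of fullv [:: x1; y1; h1; x2; y2],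
      x1 \in gr g true /\ y1 \in gr g true,
      h1 = br x1 y1,
      x2 = 2^-1 *: br x1 x1 /\ y2 = 2^-1 *: br y1 y1
    & br h1 x1 = x1 /\ br h1 y1 = - y1].

Section Osp12Basis.
Variable K : fieldType.

Let i0 : 'I_3 := @Ordinal 3 0 isT.
Let i1 : 'I_3 := @Ordinal 3 1 isT.
Let i2 : 'I_3 := @Ordinal 3 2 isT.
Let E (i j : 'I_3) : 'M[K]_3 := delta_mx i j.

Let X1 : 'M[K]_3 := E i1 i0 - E i0 i2.
Let Y1 : 'M[K]_3 := E i2 i0 + E i0 i1.
Let H1m : 'M[K]_3 := E i1 i1 - E i2 i2.
Let X2 : 'M[K]_3 := - E i1 i2.
Let Y2 : 'M[K]_3 := E i2 i1.

Let ord3 (P : 'I_3 -> Prop) : P i0 -> P i1 -> P i2 -> forall i, P i.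
Proof.
move=> p0 p1 p2 [[|[|[|//]]] hi]; rewrite ?(bool_irrelevance hi isT) //.
Qed.

Let sum3 (V : nmodType) (F : 'I_3 -> V) : \sum_i F i = F i0 + F i1 + F i2.
Proof.
rewrite !big_ord_recl big_ord0 addr0 addrA.
by congr (F _ + F _ + F _); apply: val_inj.
Qed.

Let formE v w : bform (form12 K) v w =
  v i0 0 * w i0 0 + v i1 0 * w i2 0 - v i2 0 * w i1 0.
Proof. by rewrite /bform !mxE sum3 !mxE !sum3 !mxE /=; ring. Qed.

Let mem_osp12 (A : 'M[K]_3) : 2%:R != 0 :> K ->
  A \in osp_space par12 (form12 K) <->
  [/\ A i0 i0 = 0, A i0 i1 = A i2 i0, A i0 i2 = - A i1 i0
    & A i2 i2 = - A i1 i1].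
Proof.
move=> two; split=> [/mem_osp AP|[e00 e01 e02 e22]].
  pose d (i : 'I_3) : 'cV[K]_3 := delta_mx i 0.
  have dP i : homog par12 (par12 i) (d i).
    by move=> j; rewrite mxE; case: (eqVneq j i) => [->|_] //; rewrite eqxx.
  have := AP false _ _ (d i0) (dP i0).
  have := AP true _ _ (d i1) (dP i0).
  have := AP true _ _ (d i2) (dP i0).
  have := AP false _ _ (d i2) (dP i1).
  rewrite !formE !mxE !sum3 !mxE /= !(mulr0, mulr1, mul0r, mul1r, add0r, addr0, subr0, sub0r, expr0, expr1).
  move=> h4 h3 h2 h1.
  have e22 : A i2 i2 = - A i1 i1 by apply/eqP; rewrite -addr_eq0 addrC h4.
  have e02 : A i0 i2 = - A i1 i0 by apply/eqP; rewrite -addr_eq0 addrC h3.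
  have e01 : A i0 i1 = A i2 i0 by apply/esym/eqP; rewrite -subr_eq0 -oppr_eq0 opprB addrC h2.
  split=> //; apply/eqP; move/eqP: h1.
  by rewrite -mulr2n -mulr_natl mulf_eq0 (negPf two).
apply/mem_osp=> a b v w vb; rewrite !formE !mxE !sum3 !mxE /=.
by case: a; case: b vb => vb /=;
   [rewrite (vb i0)|rewrite (vb i1) ?(vb i2)|rewrite (vb i0)|rewrite (vb i1) ?(vb i2)];
   rewrite // ?e00 ?e01 ?e02 ?e22; ring.
Qed.

(* The hypothesis [is_osp12_basis] is satisfiable in [osp12 K]. *)
Lemma osp12_basis_ex : 2%:R != 0 :> K ->
  exists x1 y1 h1 x2 y2 : osp12 K, is_osp12_basis x1 y1 h1 x2 y2.
Proof.
move=> two.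
pose U := osp_space par12 (form12 K).
have X1U : X1 \in U by apply/mem_osp12 => //; split; rewrite !mxE /=; ring.
have Y1U : Y1 \in U by apply/mem_osp12 => //; split; rewrite !mxE /=; ring.
have H1U : H1m \in U by apply/mem_osp12 => //; split; rewrite !mxE /=; ring.
have X2U : X2 \in U by apply/mem_osp12 => //; split; rewrite !mxE /=; ring.
have Y2U : Y2 \in U by apply/mem_osp12 => //; split; rewrite !mxE /=; ring.
pose mk A : osp12 K := vsproj U A.
have mkK A : A \in U -> vsval (mk A) = A by apply: vsprojK.
have X1g : X1 \in glgr K par12 true.
  by apply/mem_glgr; apply: ord3; apply: ord3 => //= _; rewrite !mxE /=; ring.
have Y1g : Y1 \in glgr K par12 true.
  by apply/mem_glgr; apply: ord3; apply: ord3 => //= _; rewrite !mxE /=; ring.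
have H1g : H1m \in glgr K par12 false.
  by apply/mem_glgr; apply: ord3; apply: ord3 => //= _; rewrite !mxE /=; ring.
have brE a b A B : A \in U -> B \in U -> A \in glgr K par12 a -> B \in glgr K par12 b ->
    br (mk A) (mk B) = mk (A *m B - (-1) ^+ (a && b) *: (B *m A)).
  move=> AU BU Aa Bb; apply: subvs_inj.
  have := osp_br AU BU; rewrite /= gl_brE (supercommE Aa Bb) => ABU.
  rewrite (vsval_sub_br (@osp_br _ _ par12 (form12 K))) !mkK //= gl_brE.
  by rewrite (supercommE Aa Bb).
have mxq (A B : 'M[K]_3) : (forall i j, A i j = B i j) -> mk A = mk B.
  by move=> AB; congr mk; apply/matrixP.
have mkZ c A : c *: mk A = mk (c *: A) by rewrite /mk linearZ.
have mkN A : - mk A = mk (- A) by rewrite /mk linearN.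
exists (mk X1), (mk Y1), (mk H1m), (mk X2), (mk Y2); split.
- rewrite /basis_of; apply/andP; split.
    apply/eqP/vspaceP=> u; rewrite memvf.
    have /mem_osp12[//|e00 e01 e02 e22] := subvsP u.
    set A := vsval u in e00 e01 e02 e22.
    have -> : u = A i1 i0 *: mk X1 + A i2 i0 *: mk Y1 + A i1 i1 *: mk H1m
                  - A i1 i2 *: mk X2 + A i2 i1 *: mk Y2.
      apply: subvs_inj; rewrite -/A.
      rewrite !(linearD, linearN, linearZ) /= !mkK //.
      apply/matrixP; apply: ord3; apply: ord3; rewrite !mxE /= ?e00 ?e01 ?e02 ?e22; ring.
    by rewrite !(memvD, memvN, memvZ, memvB) ?memv_span // !inE eqxx ?orbT.
  apply/(@freeP _ _ 5 [tuple mk X1; mk Y1; mk H1m; mk X2; mk Y2])=> c.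
  rewrite !big_ord_recl big_ord0 /= => /(congr1 (@vsval _ _ U)).
  rewrite !(linearD, linearN, linearZ, linear0) /= !mkK // => /matrixP c0.
  have := (c0 i1 i0, c0 i2 i0, c0 i1 i1, c0 i1 i2, c0 i2 i1).
  rewrite !mxE /= !(mulr0, mulr1, mulrN, oppr0, subr0, addr0, add0r, mulrN1).
  move=> [[[[k0 k1] k2] /eqP]]; rewrite oppr_eq0 => /eqP k3 k4.
  move=> [[|[|[|[|[|//]]]]] hi];
    [rewrite -[RHS]k0|rewrite -[RHS]k1|rewrite -[RHS]k2|rewrite -[RHS]k3|rewrite -[RHS]k4];
    by congr c; apply: val_inj.
- have grE A : A \in U -> A \in glgr K par12 true -> mk A \in gr (osp12 K) true.
    move=> AU Ag; change (mk A \in @sub_gr _ (gl K par12) U true).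
    by rewrite mem_sub_gr mkK.
  by split; apply: grE.
- rewrite (brE true true) //; apply: mxq; apply: ord3; apply: ord3;
    rewrite !mxE !sum3 !mxE /=; ring.
- rewrite (brE true true) // (brE true true) // !mkZ.
  by split; apply: mxq; apply: ord3; apply: ord3;
    rewrite !mxE !sum3 !mxE /=; field.
- rewrite (brE false true) // (brE false true) // mkN.
  by split; apply: mxq; apply: ord3; apply: ord3;
    rewrite !mxE !sum3 !mxE /=; ring.
Qed.

End Osp12Basis.

(* Main.v *)
(** A derivation is determined by its values on [x1] and [y1]. For an even
    derivation, [[h1, x1] = x1] makes the matrix on the odd part traceless, and
    every such matrix comes from [ad] of an even element. For an odd one,
    applying it to [[h1, x1] = x1] and [[h1, y1] = - y1] shows that, up to an
    inner derivation, it maps [x1] to [s y2] and [y1] to [t x2] with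
    [3 s = 3 t = 0]; so it vanishes unless the characteristic is 3.

    Subtracting a coboundary, a 2-cocycle [w] may be assumed to vanish on
    [(h1, x1)], [(h1, y1)], [(x1, y1)], [(x1, x1)] and [(y1, y1)]. The identity
    [w (u^2, v) = w (u, [u, v])] for [u] odd then gives [w = 0]; the value
    [w (x1, x2)] satisfies [3 w (x1, x2) = 0], and in characteristic 3 it
    vanishes by the additional cocycle condition. *)
Require Import Defs.
From mathcomp Require Import all_boot all_order all_algebra.
From mathcomp Require Import ring.

Set Implicit Arguments.
Unset Strict Implicit.
Unset Printing Implicit Defensive.

Import GRing.Theory.
Local Open Scope ring_scope.

(** * Induction on spans and vanishing of spaces of classes *)

Lemma span_ind (K : fieldType) (V : vectType K) (s : seq V) (P : V -> Prop) :
  P 0 -> (forall (a : K) u v, P u -> P v -> P (a *: u + v)) ->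
  (forall u, u \in s -> P u) -> forall v, v \in <<s>>%VS -> P v.
Proof.
move=> P0 Plin Ps v vs; apply/(mem_vspace_of _ P0 Plin).
by apply: (subvP _ _ vs); apply/span_subvP => u /Ps Pu; apply/mem_vspace_of.
Qed.

Lemma classes_of_eq0 (K : fieldType) (E : vectType K) (W Z : {vspace E}) :
  (Z <= W)%VS -> classes_of W Z = 0%VS.
Proof.
move=> /subvP ZW; apply/eqP; rewrite -subv0; apply/subvP => q.
by case/classes_ofP => z /ZW zW ->; rewrite memv0 piv_eq0.
Qed.

(** Lets [ring] use one linear hypothesis: it only has to check that both equations have the same
    difference of sides, sign included. *)
Lemma eq_of_subr (V : zmodType) (u v x y : V) : u = v -> x - y = u - v -> x = y.
Proof. by move=> ->; rewrite subrr => /subr0_eq. Qed.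

(** * Derivations of a Lie superalgebra checked on spanning sets, and inner derivations *)

Section Derivations.
Variables (K : fieldType) (g : lieSuperalgebra K).

(** For a fixed parity of [u], the Leibniz rule is linear in [u] and in [v]. The sign involves only
    the parity of [u], so [v] may run through the span of both lists together, which is all of
    [g]. *)
Lemma derivation_gens (a : bool) (D : 'End(g)) (s : bool -> seq g) :
  (forall b, gr g b = <<s b>>%VS) ->
  (forall b u, u \in s b -> D u \in gr g (a (+) b)) ->
  (forall b c u v, u \in s b -> v \in s c ->
     D (br u v) = br (D u) v + (-1) ^+ (a && b) *: br u (D v)) ->
  is_derivation a D.
Proof.
move=> grE Dgr Dbr; split=> [b|b u v].
  rewrite (grE b); apply: span_ind => [|k u v Du Dv|]; last exact: Dgr.
    by rewrite linear0 mem0v.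
  by rewrite linearP /= rpredD ?rpredZ.
rewrite (grE b) => us; move: u us v.
apply: span_ind => [v|k u1 u2 P1 P2 v|u us v].
- by rewrite !linear0 !zero_lfunE !linear0 addr0.
- rewrite !linearP /= !lfun_simp linearP /= P1 P2.
  by rewrite !scalerDr addrACA !scalerA [k * _]mulrC.
have : v \in (<<s false>> + <<s true>>)%VS by rewrite -!grE gr_full memvf.
rewrite -span_cat; move: v; apply: span_ind => [|k v1 v2 P1 P2|v].
- by rewrite !linear0 addr0.
- by rewrite !linearP /= P1 P2 !scalerDr addrACA !scalerA [k * _]mulrC.
by rewrite mem_cat => /orP[] vs; apply: (Dbr b _ u v us vs).
Qed.

Lemma ad_derivation (a : bool) (z : g) :
  z \in gr g a -> (br z : 'End(g)) \in Der_ g a.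
Proof.
move=> za; apply/mem_Der_; split=> [b x xb|b x y xb]; first exact: br_gr.
exact: br_jacobi.
Qed.

Lemma ad_inner (z : g) : (br z : 'End(g)) \in Inn g.
Proof. exact: memv_img (memvf z). Qed.

Lemma inner_of_subr (D : 'End(g)) (z : g) : D - br z = 0 -> D \in Inn g.
Proof. by move/subr0_eq->; apply: ad_inner. Qed.

End Derivations.

(** * Coordinates and parity components in any [g] with a basis satisfying the osp(1|2) relations *)

Section Osp12Cohomology.
Variables (K : fieldType) (g : lieSuperalgebra K) (x1 y1 h1 x2 y2 : g).
Hypothesis two0 : 2%:R != 0 :> K.
Hypothesis basisP : is_osp12_basis x1 y1 h1 x2 y2.

Let bt : 5.-tuple g := [tuple x1; y1; h1; x2; y2].
Let btP : basis_of fullv bt. Proof. by case: basisP. Qed.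
Let x1o : x1 \in gr g true. Proof. by case: basisP => _ []. Qed.
Let y1o : y1 \in gr g true. Proof. by case: basisP => _ []. Qed.
Let h1E : h1 = br x1 y1. Proof. by case: basisP. Qed.
Let x2E : x2 = 2^-1 *: br x1 x1. Proof. by case: basisP => _ _ _ []. Qed.
Let y2E : y2 = 2^-1 *: br y1 y1. Proof. by case: basisP => _ _ _ []. Qed.
Let hx : br h1 x1 = x1. Proof. by case: basisP => _ _ _ _ []. Qed.
Let hy : br h1 y1 = - y1. Proof. by case: basisP => _ _ _ _ []. Qed.
Let h1e : h1 \in gr g false. Proof. by rewrite h1E (br_gr x1o y1o). Qed.
Let x2e : x2 \in gr g false. Proof. by rewrite x2E rpredZ ?(br_gr x1o x1o). Qed.
Let y2e : y2 \in gr g false. Proof. by rewrite y2E rpredZ ?(br_gr y1o y1o). Qed.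

(** Coordinates turn an identity between vectors into five identities in [K], which [ring] can
    decide after rewriting with [crdE]. *)
Let crd (i : 'I_5) (v : g) : K := coord bt i v.

Let crdD i u v : crd i (u + v) = crd i u + crd i v.
Proof. by rewrite /crd linearD. Qed.
Let crdN i u : crd i (- u) = - crd i u.
Proof. by rewrite /crd linearN. Qed.
Let crdZ i a u : crd i (a *: u) = a * crd i u.
Proof. by rewrite /crd linearZ. Qed.
Let crd0 i : crd i 0 = 0.
Proof. by rewrite /crd linear0. Qed.
Let crdB (i j : 'I_5) : crd j bt`_i = (i == j)%:R.
Proof. by rewrite /crd coord_free ?(basis_free btP). Qed.

Let k0 : 'I_5 := @Ordinal 5 0 isT.
Let k1 : 'I_5 := @Ordinal 5 1 isT.
Let k2 : 'I_5 := @Ordinal 5 2 isT.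
Let k3 : 'I_5 := @Ordinal 5 3 isT.
Let k4 : 'I_5 := @Ordinal 5 4 isT.
Let crdx1 j : crd j x1 = (k0 == j)%:R. Proof. exact: (crdB k0). Qed.
Let crdy1 j : crd j y1 = (k1 == j)%:R. Proof. exact: (crdB k1). Qed.
Let crdh1 j : crd j h1 = (k2 == j)%:R. Proof. exact: (crdB k2). Qed.
Let crdx2 j : crd j x2 = (k3 == j)%:R. Proof. exact: (crdB k3). Qed.
Let crdy2 j : crd j y2 = (k4 == j)%:R. Proof. exact: (crdB k4). Qed.
Let crdE := (crdD, crdN, crdZ, crd0, crdx1, crdy1, crdh1, crdx2, crdy2).

Let decomp v : v = crd k0 v *: x1 + crd k1 v *: y1
  + (crd k2 v *: h1 + crd k3 v *: x2 + crd k4 v *: y2).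
Proof.
rewrite {1}(coord_basis btP (memvf v)) !big_ord_recl big_ord0 /= addr0 !addrA.
by congr (_ *: _ + _ *: _ + _ *: _ + _ *: _ + _ *: _); congr (coord bt _ v);
  apply: val_inj.
Qed.

Let crd_inj u v : crd k0 u = crd k0 v -> crd k1 u = crd k1 v ->
  crd k2 u = crd k2 v -> crd k3 u = crd k3 v -> crd k4 u = crd k4 v -> u = v.
(* The first five occurrences are in the coordinate hypotheses; the sixth is the one in the
   conclusion. *)
Proof. by rewrite {6}[u]decomp {6}[v]decomp => -> -> -> -> ->. Qed.

Let scalev2_inj (V : lmodType K) (u v : V) : 2%:R *: u = 2%:R *: v -> u = v.
Proof. exact: scalerI. Qed.

Let odd0 a b : a *: x1 + b *: y1 \in gr g true.
Proof. by rewrite rpredD ?rpredZ. Qed.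
Let even0 a b c : a *: h1 + b *: x2 + c *: y2 \in gr g false.
Proof. by rewrite !rpredD ?rpredZ. Qed.

Let gr_disjoint v : v \in gr g false -> v \in gr g true -> v = 0.
Proof. by move=> v0 v1; apply/eqP; rewrite -memv0 -(gr_cap g) memv_cap v0. Qed.

(** The difference of the two sides is odd, and by [decomp] it is a combination of [h1], [x2], [y2],
    hence also even; the components meet in 0. *)
Let oddE v : v \in gr g true -> v = crd k0 v *: x1 + crd k1 v *: y1.
Proof.
move=> vo; apply/eqP; rewrite -subr_eq0; apply/eqP/gr_disjoint; last first.
  by rewrite rpredB ?odd0.
by rewrite {1}[v]decomp addrC addKr even0.
Qed.

Let evenE v : v \in gr g false ->
  v = crd k2 v *: h1 + crd k3 v *: x2 + crd k4 v *: y2.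
Proof.
move=> ve; apply/eqP; rewrite -subr_eq0; apply/eqP/gr_disjoint.
  by rewrite rpredB ?even0.
by rewrite {1}[v]decomp addrK odd0.
Qed.

Let gens (b : bool) : seq g := if b then [:: x1; y1] else [:: h1; x2; y2].

Let gr_gens b : gr g b = <<gens b>>%VS.
Proof.
apply/eqP; rewrite eqEsubv; apply/andP; split; apply/subvP => v; last first.
  by apply/subvP/span_subvP => u; case: (b) => /=; rewrite !inE;
     [case/orP=> /eqP->|case/or3P=> /eqP->].
case: b => /= vP; [rewrite (oddE vP) | rewrite (evenE vP)];
by rewrite !memvD ?memvZ ?memv_span // !inE eqxx ?orbT.
Qed.

(** * The multiplication table *)

Let xx : br x1 x1 = 2%:R *: x2.
Proof. by rewrite x2E scalerA divff // scale1r. Qed.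
Let yy : br y1 y1 = 2%:R *: y2.
Proof. by rewrite y2E scalerA divff // scale1r. Qed.
Let xy : br x1 y1 = h1. Proof. by []. Qed.
Let yx : br y1 x1 = h1.
Proof. by rewrite (br_skew y1o x1o) xy /= scaleN1r opprK. Qed.
Let xh : br x1 h1 = - x1.
Proof. by rewrite (br_skew x1o h1e) hx /= scale1r. Qed.
Let yh : br y1 h1 = y1.
Proof. by rewrite (br_skew y1o h1e) hy /= scale1r opprK. Qed.

(** The Jacobi identity at [u], [u], [u] and skew-symmetry give [3 [u, [u, u]] = 0]; characteristic
    3 needs the cubic axiom. *)
Let odd_cube u : u \in gr g true -> br u (br u u) = 0.
Proof.
move=> uo; have [p3|np3] := boolP (3%N \in [pchar K]); first exact: br_cubic.
have := br_jacobi u uo uo; rewrite (br_skew (br_gr uo uo) uo) /= scale1r scaleN1r.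
move/eqP; rewrite -subr_eq0 !opprD !opprK addrA -mulr2n -mulrSr -scaler_nat.
by move: np3; rewrite scaler_eq0 inE /= => /negPf-> /eqP.
Qed.

Let xx2 : br x1 x2 = 0. Proof. by rewrite x2E linearZ /= odd_cube ?scaler0. Qed.
Let yy2 : br y1 y2 = 0. Proof. by rewrite y2E linearZ /= odd_cube ?scaler0. Qed.
Let x2x : br x2 x1 = 0.
Proof. by rewrite (br_skew x2e x1o) xx2 scaler0 oppr0. Qed.
Let y2y : br y2 y1 = 0.
Proof. by rewrite (br_skew y2e y1o) yy2 scaler0 oppr0. Qed.

(** The Jacobi identity for the pair [x1], [x1] reads [[[x1, x1], v] = 2 [x1, [x1, v]]], so [ad x2]
    is the square of [ad x1]. This reduces the brackets with [x2] to those with [x1]. *)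
Let br2x v : br x2 v = br x1 (br x1 v).
Proof.
rewrite x2E linearZ lfunE /= (_ : br (br x1 x1) v = 2%:R *: br x1 (br x1 v)).
  by rewrite scalerA mulVf // scale1r.
have := br_jacobi v x1o x1o; rewrite /= scaleN1r => e.
by rewrite scaler_nat mulr2n {1}e subrK.
Qed.
Let br2y v : br y2 v = br y1 (br y1 v).
Proof.
rewrite y2E linearZ lfunE /= (_ : br (br y1 y1) v = 2%:R *: br y1 (br y1 v)).
  by rewrite scalerA mulVf // scale1r.
have := br_jacobi v y1o y1o; rewrite /= scaleN1r => e.
by rewrite scaler_nat mulr2n {1}e subrK.
Qed.

Let x2y : br x2 y1 = - x1. Proof. by rewrite br2x xy xh. Qed.
Let y2x : br y2 x1 = y1. Proof. by rewrite br2y yx yh. Qed.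
Let yx2 : br y1 x2 = x1.
Proof. by rewrite (br_skew y1o x2e) x2y /= scale1r opprK. Qed.
Let xy2 : br x1 y2 = - y1.
Proof. by rewrite (br_skew x1o y2e) y2x /= scale1r. Qed.
Let x2h : br x2 h1 = - (2%:R *: x2). Proof. by rewrite br2x xh linearN /= xx. Qed.
Let y2h : br y2 h1 = 2%:R *: y2. Proof. by rewrite br2y yh yy. Qed.
Let hx2 : br h1 x2 = 2%:R *: x2.
Proof. by rewrite (br_skew h1e x2e) x2h /= scale1r opprK. Qed.
Let hy2 : br h1 y2 = - (2%:R *: y2).
Proof. by rewrite (br_skew h1e y2e) y2h /= scale1r. Qed.
Let x2y2 : br x2 y2 = - h1. Proof. by rewrite br2x xy2 linearN /= xy. Qed.
Let y2x2 : br y2 x2 = h1. Proof. by rewrite br2y yx2 yx. Qed.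
Let hh : br h1 h1 = 0.
Proof.
by apply: scalev2_inj; rewrite scaler0 scaler_nat mulr2n
  {1}(br_skew h1e h1e) /= scale1r addNr.
Qed.
Let x2x2 : br x2 x2 = 0. Proof. by rewrite br2x xx2 linear0. Qed.
Let y2y2 : br y2 y2 = 0. Proof. by rewrite br2y yy2 linear0. Qed.

Let brE := (xx, xy, yx, yy, xh, hx, yh, hy, xx2, x2x, yx2, x2y, xy2, y2x,
  yy2, y2y, hh, hx2, x2h, hy2, y2h, x2x2, y2y2, x2y2, y2x2).

(** * Even and odd derivations modulo inner ones *)

Let hom_eq0 (V : vectType K) (f : 'Hom(g, V)) :
  f x1 = 0 -> f y1 = 0 -> f h1 = 0 -> f x2 = 0 -> f y2 = 0 -> f = 0.
Proof.
move=> fx fy fh fx2 fy2; apply/lfunP => v.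
rewrite zero_lfunE [v]decomp !linearD !linearZ /= fx fy fh fx2 fy2.
by rewrite !scaler0 !addr0.
Qed.

Let eqc i (u v : g) : u = v -> crd i u = crd i v. Proof. by move=> ->. Qed.

(** The elements [x1] and [y1] generate the superalgebra: the other basis vectors are multiples of
    brackets of these two. *)
Lemma osp12_derivation_eq0 (a : bool) (D : 'End(g)) :
  D \in Der_ g a -> D x1 = 0 -> D y1 = 0 -> D = 0.
Proof.
case/mem_Der_ => _ Dbr Dx Dy.
have Dh : D h1 = 0.
  by rewrite h1E (Dbr true _ _ x1o) Dx Dy !linear0 zero_lfunE addr0.
have Dx2 : D x2 = 0.
  by rewrite x2E linearZ /= (Dbr true _ _ x1o) Dx !linear0 zero_lfunE addr0 linear0.
have Dy2 : D y2 = 0.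
  by rewrite y2E linearZ /= (Dbr true _ _ y1o) Dy !linear0 zero_lfunE addr0 linear0.
exact: hom_eq0.
Qed.

Lemma osp12_even_derivation_inner (D : 'End(g)) :
  D \in Der_ g false -> D \in Inn g.
Proof.
move=> D0; have [Dgr Dbr] := (mem_Der_ _ _).1 D0.
have Dx := oddE (Dgr true _ x1o); have Dy := oddE (Dgr true _ y1o).
set a := crd k0 _ in Dx; set b := crd k1 _ in Dx.
set c := crd k0 _ in Dy; set d := crd k1 _ in Dy.
have Dh : D h1 = (a + d) *: h1 + (2%:R * b) *: y2 + (2%:R * c) *: x2.
  rewrite {1}h1E (Dbr true _ _ x1o) /= scale1r Dx Dy.
  rewrite !(linearD, linearN, linearZ, lfun_simp) /= !brE.
  by apply: crd_inj; rewrite !crdE /=; ring.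
(* The [x1]-coordinate of the Leibniz rule for [[h1, x1] = x1] is [a = (a + d) + a]. *)
have ad0 : a + d = 0.
  have := Dbr false h1 x1 h1e; rewrite hx /= scale1r Dh Dx.
  rewrite !(linearD, linearN, linearZ, lfun_simp) /= !brE.
  move/(eqc k0); rewrite !crdE /= => /esym e.
  by apply: (eq_of_subr e); ring.
(* On the odd part, [ad h1] is diagonal with entries 1 and -1, [ad y2] sends [x1] to [y1], and
   [ad x2] sends [y1] to [- x1], whence the sign of [c]. *)
pose z := a *: h1 + b *: y2 - c *: x2.
have z0 : z \in gr g false by rewrite rpredB ?rpredD ?rpredZ.
apply: (inner_of_subr (z := z)).
apply: (osp12_derivation_eq0 (a := false)).
- by rewrite rpredB ?ad_derivation.
- rewrite !(linearD, linearN, linearZ, lfun_simp) /= Dx !brE.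
  by apply: crd_inj; rewrite !crdE /=; ring.
- rewrite !(linearD, linearN, linearZ, lfun_simp) /= Dy !brE.
  by apply: crd_inj; rewrite !crdE /=; first [ring | apply: (eq_of_subr ad0); ring].
Qed.

Lemma osp12_odd_derivation (D : 'End(g)) : D \in Der_ g true ->
  exists z s t, [/\ z \in gr g true, 3%:R * s = 0, 3%:R * t = 0,
    D x1 = br z x1 + s *: y2 & D y1 = br z y1 + t *: x2].
Proof.
move=> D1; have [Dgr Dbr] := (mem_Der_ _ _).1 D1.
have Dx := evenE (Dgr true _ x1o); have Dy := evenE (Dgr true _ y1o).
set a := crd k2 _ in Dx; set b := crd k3 _ in Dx; set c := crd k4 _ in Dx.
set a' := crd k2 _ in Dy; set b' := crd k3 _ in Dy; set c' := crd k4 _ in Dy.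
have Dh : D h1 = (a' - b) *: x1 + (c' - a) *: y1.
  rewrite {1}h1E (Dbr true _ _ x1o) /= scaleN1r Dx Dy.
  rewrite !(linearD, linearN, linearZ, lfun_simp) /= !brE.
  by apply: crd_inj; rewrite !crdE /=; ring.
have := Dbr false h1 x1 h1e; rewrite hx /= scale1r Dh Dx.
rewrite !(linearD, linearN, linearZ, lfun_simp) /= !brE => ex.
have := Dbr false h1 y1 h1e; rewrite hy linearN /= scale1r Dh Dy.
rewrite !(linearD, linearN, linearZ, lfun_simp) /= !brE => ey.
(* The [h1]-coordinates of [ex] and [ey] tie [c'] to [a] and [b] to [a']. The [y2]-coordinate of
   [ex] gives [c = - 2 c], and the [x2]-coordinate of [ey] gives [- b' = 2 b']. *)
have c'E : c' = 2%:R * a.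
  by move/(eqc k2): ex; rewrite !crdE /= => /esym e; apply: (eq_of_subr e); ring.
have bE : b = 2%:R * a'.
  by move/(eqc k2): ey; rewrite !crdE /= => e; apply: (eq_of_subr e); ring.
(* The bracket of [a' x1 + a y1] with [x1] is [2 a' x2 + a h1], and with [y1] it is
   [a' h1 + 2 a y2]; only [c y2] and [b' x2] are left over. *)
exists (a' *: x1 + a *: y1), c, b'; split.
- by rewrite rpredD ?rpredZ.
- by move/(eqc k4): ex; rewrite !crdE /= => e; apply: (eq_of_subr e); ring.
- by move/(eqc k3): ey; rewrite !crdE /= => /esym e; apply: (eq_of_subr e); ring.
- rewrite bE !(linearD, linearN, linearZ, lfun_simp) /= !brE.
  by apply: crd_inj; rewrite !crdE /=; ring.
- rewrite c'E !(linearD, linearN, linearZ, lfun_simp) /= !brE.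
  by apply: crd_inj; rewrite !crdE /=; ring.
Qed.

(** * Normalized 2-cocycles and the second cohomology *)

Lemma osp12_cocycle_eq0 (w : 'Hom(g, 'Hom(g, K^o))) : w \in Z2 g ->
  w h1 x1 = 0 -> w h1 y1 = 0 -> w x1 y1 = 0 -> w x1 x1 = 0 -> w y1 y1 = 0 ->
  w = 0.
Proof.
case/mem_Z2 => ws wb w3 whx why wxy wxx wyy.
have sw a b u v : u \in gr g a -> v \in gr g b -> w v u = 0 -> w u v = 0.
  by move=> ua vb vu0; rewrite (ws a b) // vu0 mulr0 oppr0.
have even_sq u : u \in gr g false -> w u u = 0.
  move=> u0; apply: (scalev2_inj (V := K^o)).
  by rewrite scaler0 scaler_nat mulr2n {1}(ws _ _ _ _ u0 u0) /= mul1r addNr.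
have sq u v : u \in gr g true -> w (2%:R^-1 *: br u u) v = w u (br u v).
  move=> u1; rewrite linearZ lfunE /= (wb true true) //= mulN1r opprK.
  by rewrite -mulr2n -scaler_nat scalerA mulVf // scale1r.
have w2x v : w x2 v = w x1 (br x1 v) by rewrite -sq // -x2E.
have w2y v : w y2 v = w y1 (br y1 v) by rewrite -sq // -y2E.
(* The cocycle identity at [u], [u], [u] gives [w ([u, u], u) = 2 w (u, [u, u])], while
   skew-symmetry gives the opposite of [w (u, [u, u])]; hence a factor 3. *)
have cube u : u \in gr g true -> w u (br u u) = 0.
  move=> u1; have [p3|np3] := boolP (3%N \in [pchar K]); first exact: w3.
  have := wb true true u u u u1 u1; rewrite (ws false true) ?(br_gr u1 u1) //.
  rewrite /= mul1r mulN1r opprK => /eqP; rewrite -subr_eq0 -oppr_eq0 !opprD !opprK.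
  move: np3; rewrite addrC -mulr2n -mulrSr -scaler_nat scaler_eq0 inE /=.
  by move=> /negPf-> /eqP.
have wxx2 : w x1 x2 = 0 by rewrite x2E linearZ /= cube ?scaler0.
have wyy2 : w y1 y2 = 0 by rewrite y2E linearZ /= cube ?scaler0.
have wxh := sw _ _ _ _ x1o h1e whx; have wyh := sw _ _ _ _ y1o h1e why.
have wyx := sw _ _ _ _ y1o x1o wxy.
have wx2x := sw _ _ _ _ x2e x1o wxx2; have wy2y := sw _ _ _ _ y2e y1o wyy2.
(* Values with [x2] or [y2] in the first slot reduce by [w2x] and [w2y] to values already known to
   vanish. *)
have wx2y : w x2 y1 = 0 by rewrite w2x xy.
have wy2x : w y2 x1 = 0 by rewrite w2y yx.
have wyx2 := sw _ _ _ _ y1o x2e wx2y; have wxy2 := sw _ _ _ _ x1o y2e wy2x.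
have wx2h : w x2 h1 = 0 by rewrite w2x xh linearN /= wxx oppr0.
have wy2h : w y2 h1 = 0 by rewrite w2y yh.
have whx2 := sw _ _ _ _ h1e x2e wx2h; have why2 := sw _ _ _ _ h1e y2e wy2h.
have wx2y2 : w x2 y2 = 0 by rewrite w2x xy2 linearN /= wxy oppr0.
have wy2x2 := sw _ _ _ _ y2e x2e wx2y2.
have [[whh wx2x2] wy2y2] := (even_sq _ h1e, even_sq _ x2e, even_sq _ y2e).
(* The first pass treats [w] as a map into linear forms, the second treats each form obtained. *)
by do 2![apply: hom_eq0; rewrite ?zero_lfunE //].
Qed.

Lemma osp12_H2_eq0 : H2 g = 0%VS.
Proof.
apply: classes_of_eq0; apply/subvP => w wZ.
(* The entries are forced by [f [u, v] = w (u, v)] on the five normalized pairs: [[h1, y1] = - y1]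
   gives the sign, [[x1, x1] = 2 x2] and [[y1, y1] = 2 y2] the halves. *)
pose s : seq K^o := [:: w h1 x1; - w h1 y1; w x1 y1;
  2%:R^-1 *: w x1 x1; 2%:R^-1 *: w y1 y1].
pose f : 'Hom(g, K^o) := basis_map bt s.
have /= := @basis_mapE K g K^o bt s btP erefl; rewrite -/f => -[fx fy fh fx2 fy2].
pose df : 'Hom(g, 'Hom(g, K^o)) := bilinfun (fun u v => f (br u v)).
have dfE u v : df u v = f (br u v).
  rewrite bilinfunE // => [x|y] k u1 u2; first by rewrite !linearP.
  by rewrite linearP !lfun_simp linearP.
have dfB : df \in B2 g by apply/mem_B2; exists f.
suff: w - df = 0 by move/eqP; rewrite subr_eq0 => /eqP->.
apply: osp12_cocycle_eq0; rewrite ?lfun_simp ?dfE ?brE ?linearN ?linearZ /=.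
- by rewrite rpredB // (subvP (B2_sub_Z2 g)).
- by rewrite fx subrr.
- by rewrite fy opprK subrr.
- by rewrite fh subrr.
- by rewrite scalerN fx2 scalerA divff // scale1r subrr.
- by rewrite scalerN fy2 scalerA divff // scale1r subrr.
Qed.

(** * The first cohomology when 3 is invertible *)

Lemma osp12_H1_eq0 : 3%:R != 0 :> K -> H1 g = 0%VS.
Proof.
move=> three0; have kill (s : K) : 3%:R * s = 0 -> s = 0.
  by move/eqP; rewrite mulf_eq0 (negPf three0) => /eqP.
apply: classes_of_eq0; apply/subvP => _ /memv_addP[D0 D0P [D1 D1P ->]].
rewrite rpredD ?(osp12_even_derivation_inner D0P) //.
have [z [s [t [z1 /kill s0 /kill t0 Dx Dy]]]] := osp12_odd_derivation D1P.
apply: (inner_of_subr (z := z)).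
apply: (osp12_derivation_eq0 (a := true)).
- by rewrite rpredB ?ad_derivation.
- by rewrite !lfun_simp Dx s0 scale0r addr0 subrr.
- by rewrite !lfun_simp Dy t0 scale0r addr0 subrr.
Qed.

(** * The two outer derivations in characteristic 3 *)

Section Characteristic3.
Hypothesis three0 : 3%:R = 0 :> K.

Let Dm3 : 'End(g) := basis_map bt [:: y2; 0; 0; y1; 0].
Let D3 : 'End(g) := basis_map bt [:: 0; x2; 0; 0; - x1].

Let Dm3E : [/\ Dm3 x1 = y2, Dm3 y1 = 0, Dm3 h1 = 0, Dm3 x2 = y1 & Dm3 y2 = 0].
Proof. by have /= [] := @basis_mapE K g g bt [:: y2; 0; 0; y1; 0] btP erefl. Qed.
Let D3E : [/\ D3 x1 = 0, D3 y1 = x2, D3 h1 = 0, D3 x2 = 0 & D3 y2 = - x1].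
Proof. by have /= [] := @basis_mapE K g g bt [:: 0; x2; 0; 0; - x1] btP erefl. Qed.

Let gensP (P : bool -> g -> Prop) : P true x1 -> P true y1 ->
  P false h1 -> P false x2 -> P false y2 -> forall b u, u \in gens b -> P b u.
Proof.
by move=> ? ? ? ? ? [] u /=; rewrite !inE; [case/orP=> /eqP->|case/or3P=> /eqP->].
Qed.

Lemma osp12_Dm3_derivation : is_derivation true Dm3.
Proof.
have [Dx Dy Dh Dx2 Dy2] := Dm3E.
apply: (derivation_gens gr_gens).
  by apply: gensP; rewrite ?Dx ?Dy ?Dh ?Dx2 ?Dy2 ?mem0v.
move=> b c u v ub; move: c v; move: b u ub.
(* The two enumerations produce all 25 pairs of basis vectors. Each coordinate identity holds
   outright or has discrepancy 3 or -3, hence both orientations of [three0]. *)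
by apply: gensP; apply: gensP; rewrite ?brE ?linearN ?linearZ ?linear0 /=
  ?(Dx, Dy, Dh, Dx2, Dy2)
  ?(linear0, zero_lfunE, linearN, opp_lfunE) /= ?brE;
  apply: crd_inj; rewrite !crdE /= ?expr1;
  first [ring | apply: (eq_of_subr three0); ring
              | apply: (eq_of_subr (esym three0)); ring].
Qed.

Lemma osp12_D3_derivation : is_derivation true D3.
Proof.
have [Dx Dy Dh Dx2 Dy2] := D3E.
apply: (derivation_gens gr_gens).
  by apply: gensP; rewrite ?Dx ?Dy ?Dh ?Dx2 ?Dy2 ?mem0v ?rpredN.
move=> b c u v ub; move: c v; move: b u ub.
by apply: gensP; apply: gensP; rewrite ?brE ?linearN ?linearZ ?linear0 /=
  ?(Dx, Dy, Dh, Dx2, Dy2)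
  ?(linear0, zero_lfunE, linearN, opp_lfunE) /= ?brE;
  apply: crd_inj; rewrite !crdE /= ?expr1;
  first [ring | apply: (eq_of_subr three0); ring
              | apply: (eq_of_subr (esym three0)); ring].
Qed.

(** For every [z], the bracket [[z, x1]] has no [y2]-coordinate and [[z, y1]] no [x2]-coordinate,
    whereas the combination has [s] and [t] there. *)
Lemma osp12_outer_free s t : s *: Dm3 + t *: D3 \in Inn g -> s = 0 /\ t = 0.
Proof.
have [[mx my _ _ _] [dx dy _ _ _]] := (Dm3E, D3E).
case/memv_imgP => z _ /lfunP e; have [ex ey] := (e x1, e y1).
move: ex ey; rewrite !(add_lfunE, scale_lfunE) mx my dx dy.
rewrite [z]decomp !(linearD, linearZ) /= !lfun_simp !brE.
move=> /(eqc k4) ex /(eqc k3) ey; move: ex ey; rewrite !crdE /= => ex ey.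
by split; [apply: (eq_of_subr ex) | apply: (eq_of_subr ey)]; ring.
Qed.

Lemma osp12_H1_basis :
  basis_of (H1 g) [:: piv (Inn g) Dm3; piv (Inn g) D3].
Proof.
have DmD := (mem_Der_ _ _).2 osp12_Dm3_derivation.
have DD := (mem_Der_ _ _).2 osp12_D3_derivation.
apply/andP; split; last first.
  apply/(@freeP _ _ 2 [tuple piv (Inn g) Dm3; piv (Inn g) D3]) => k.
  rewrite !big_ord_recl big_ord0 addr0 /= -!linearZ -linearD /= => /eqP.
  rewrite piv_eq0 => /osp12_outer_free[e0 e1] [[|[|//]] hi].
    by rewrite -[RHS]e0; congr k; apply: val_inj.
  by rewrite -[RHS]e1; congr k; apply: val_inj.
rewrite eqEsubv; apply/andP; split.
  apply/span_subvP => q; rewrite !inE => /orP[] /eqP->; apply/classes_ofP.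
    by exists Dm3 => //; apply: (subvP (addvSr _ _)).
  by exists D3 => //; apply: (subvP (addvSr _ _)).
apply/subvP => _ /classes_ofP[_ /memv_addP[D0 D0P [D1 D1P ->]] ->].
have [z [s [t [z1 _ _ Dx Dy]]]] := osp12_odd_derivation D1P.
have [[mx my _ _ _] [dx dy _ _ _]] := (Dm3E, D3E).
(* Both sides are odd derivations with the same values on the generators [x1] and [y1]. *)
have /subr0_eq D1E : D1 - (br z + (s *: Dm3 + t *: D3)) = 0.
  apply: (osp12_derivation_eq0 (a := true)).
  - by rewrite rpredB ?rpredD ?rpredZ ?ad_derivation.
  - by rewrite !(add_lfunE, opp_lfunE, scale_lfunE) Dx mx dx scaler0 addr0 subrr.
  - by rewrite !(add_lfunE, opp_lfunE, scale_lfunE) Dy my dy scaler0 add0r subrr.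
have /eqP pD0 : piv (Inn g) D0 == 0 by rewrite piv_eq0 osp12_even_derivation_inner.
have /eqP pz : piv (Inn g) (br z) == 0 by rewrite piv_eq0 ad_inner.
rewrite linearD /= pD0 add0r D1E !linearD !linearZ /= pz add0r.
by rewrite rpredD ?rpredZ ?memv_span ?inE ?eqxx ?orbT.
Qed.

End Characteristic3.

End Osp12Cohomology.

(** * Specialization to [osp12 K], split according to the characteristic *)

Theorem lemma2p6 (p : nat) (K : closedFieldType)
    (charK : p \in [pchar K]) (p_gt2 : (2 < p)%N)
    (x1 y1 h1 x2 y2 : osp12 K)
    (basisP : is_osp12_basis x1 y1 h1 x2 y2) :
  ((3 < p)%N -> H1 (osp12 K) = 0%VS /\ H2 (osp12 K) = 0%VS) /\
  (p = 3%N ->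
     let b := [:: x1; y1; h1; x2; y2] in
     let Dm3 : 'End(osp12 K) := basis_map b [:: y2; 0; 0; y1; 0] in
     let D3 : 'End(osp12 K) := basis_map b [:: 0; x2; 0; 0; - x1] in
     [/\ is_derivation true Dm3,
         is_derivation true D3,
         basis_of (H1 (osp12 K))
           [:: piv (Inn (osp12 K)) Dm3; piv (Inn (osp12 K)) D3]
       & H2 (osp12 K) = 0%VS]).
Proof.
have natr_neq0 n : (0 < n < p)%N -> n%:R != 0 :> K.
  by case/andP => n0 np; rewrite -(dvdn_pcharf charK) gtnNdvd.
have two0 : 2%:R != 0 :> K by rewrite natr_neq0.
split=> [p_gt3|p3].
  by split; [apply: osp12_H1_eq0 basisP _; rewrite ?natr_neq0
           | apply: osp12_H2_eq0 basisP].
have three0 : 3%:R = 0 :> K by apply/eqP; rewrite -(dvdn_pcharf charK) p3.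
split; [exact: osp12_Dm3_derivation|exact: osp12_D3_derivation
       |exact: osp12_H1_basis|exact: osp12_H2_eq0 basisP].
Qed.
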